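(* Let $n\in\mathbb{N}$, $b\in\mathbb{R}^n$, and let $Q=(q_{ij})\in\mathbb{R}^{n\times n}$ be symmetric such that $f(x)=b^Tx+x^TQx$ is individually subadditive on $\{0,1\}^n$, i.e. $f(x)\le\sum_{i}f(\mathbf{e}_i)x_i$ for all $x\in\{0,1\}^n$ (equivalently $q_{ij}\le 0$ for all $i\ne j$). Let $q=(q_{11},\dots,q_{nn})^T$ and consider the combinatorial quadratic game $$\nu(w)=\max_{x\in\{0,1\}^n}\left[b^Tx+x^TQx:\ x\le w\right],\qquad w\in\{0,1\}^n.$$ Then $\nu$ has a non-empty core if and only if $q_{ij}=0$ for all distinct $i,j\in\{k\in[n]:(b+q)^T\mathbf{e}_k>0\}$. Moreover, whenever the core is non-empty, it has the unique member $y=(b+q)^+$.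
   Context: Notation: $[n]=\{1,\dots,n\}$; $\mathbf{e}_i$ is the $i$-th unit vector; $\mathbf{1}_n$ is the all-one vector; $z^+$ is the componentwise positive part $\max\{z,0\}$; vector inequalities are componentwise. The core of a (revenue) game $\nu:\{0,1\}^n\to\mathbb{R}$ is $\mathrm{core}(\nu)=\{y\in\mathbb{R}^n:\mathbf{1}_n^Ty=\nu(\mathbf{1}_n),\ a^Ty\ge\nu(a)\ \forall a\in\{0,1\}^n\}$. *)

(* Defs.v *)
From mathcomp Require Import all_boot all_order all_algebra.
From mathcomp Require Import classical_sets reals.

Set Implicit Arguments.
Unset Strict Implicit.
Unset Printing Implicit Defensive.

Import Order.TTheory GRing.Theory Num.Theory.
Local Open Scope ring_scope.

(* Binary vectors in {0,1}^n are Boolean columns, a finite type, embedded into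
   R^n by true |-> 1 and false |-> 0. *)
Notation binvec n := 'cV[bool]_n.

Definition bin2vec (R : realType) (n : nat) (x : binvec n) : 'cV[R]_n :=
  map_mx (fun c : bool => c%:R) x.
Arguments bin2vec R {n} x.

Definition dot (R : realType) (n : nat) (u v : 'cV[R]_n) : R :=
  (u^T *m v) 0 0.

Definition unitvec (R : realType) (n : nat) (i : 'I_n) : 'cV[R]_n :=
  delta_mx i 0.
Arguments unitvec R {n} i.

Definition vecle (R : realType) (n : nat) (u v : 'cV[R]_n) : bool :=
  [forall i, u i 0 <= v i 0].

Definition vecpos (R : realType) (n : nat) (z : 'cV[R]_n) : 'cV[R]_n :=
  \col_i Num.max (z i 0) 0.

Definition diagvec (R : realType) (n : nat) (Q : 'M[R]_n) : 'cV[R]_n :=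
  \col_i Q i i.

Definition quadfun (R : realType) (n : nat) (b : 'cV[R]_n) (Q : 'M[R]_n)
    (x : 'cV[R]_n) : R :=
  dot b x + dot x (Q *m x).

Definition individually_subadditive (R : realType) (n : nat)
    (f : 'cV[R]_n -> R) : Prop :=
  forall x : binvec n,
    f (bin2vec R x) <= \sum_i f (unitvec R i) * bin2vec R x i 0.

(* The default value f 0 of the iterated maximum is the objective value of the
   zero vector, which is feasible for every w; so this is the true maximum. *)
Definition comb_game (R : realType) (n : nat) (f : 'cV[R]_n -> R)
    (w : binvec n) : R :=
  \big[Num.max/f 0]_(x : binvec n | vecle (bin2vec R x) (bin2vec R w))
     f (bin2vec R x).

Definition core (R : realType) (n : nat) (nu : binvec n -> R) : set 'cV[R]_n :=
  [set y | dot (const_mx 1) y = nu (const_mx true)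
         /\ forall a : binvec n, dot (bin2vec R a) y >= nu a]%classic.

(* Main.v *)
Require Import Defs.
From mathcomp Require Import all_boot all_order all_algebra.
From mathcomp Require Import classical_sets reals.

Set Implicit Arguments.
Unset Strict Implicit.
Unset Printing Implicit Defensive.

Import Order.TTheory GRing.Theory Num.Theory.
Local Open Scope classical_set_scope.
Local Open Scope ring_scope.

(** Write [c = b + q], so that [c_i = f(e_i)].  On a binary vector [x] the
    objective splits as
      [f(x) = sum_(i in x) c_i + sum_(i, j in x, i <> j) q_ij]
    (lemma [quadfun_bin]), because [x_i ^ 2 = x_i].  Evaluating at
    [x = e_i + e_j] shows that individual subadditivity says exactly that the
    off-diagonal entries of [Q] are nonpositive.

    Then [f(x) <= sum_(i in x) c_i^+], hence [nu(w) <= sum_(i in w) c_i^+] for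
    all [w] ([comb_game_le_pos]).  On the other hand a core member [y] satisfies
    [y_i >= nu(e_i) >= c_i^+], while [sum_i y_i = nu(1) <= sum_i c_i^+].  So
    [y = c^+], and the core is contained in the singleton of [c^+]; it is
    non-empty precisely when [nu(1) = sum_i c_i^+].  Equality at a maximizer [x]
    forces every term lost in the upper bound to vanish: [x] contains all [k]
    with [c_k > 0], and [q_ij = 0] for distinct [i, j] in [x]
    ([quadfun_eq_pos]).  Conversely, if [q_ij = 0] for distinct [i, j] with
    [c_i, c_j > 0], the indicator of [{k | c_k > 0}] attains the bound
    ([quadfun_posind]). *)

Lemma dot_sum (R : realType) (n : nat) (u v : 'cV[R]_n) :
  dot u v = \sum_i u i 0 * v i 0.
Proof. by rewrite /dot mxE; apply: eq_bigr => i _; rewrite mxE. Qed.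

Lemma dot_unitvec (R : realType) (n : nat) (u : 'cV[R]_n) (i : 'I_n) :
  dot u (unitvec R i) = u i 0.
Proof.
rewrite dot_sum (bigD1 i) //= big1 => [|j ji]; rewrite !mxE ?eqxx ?mulr1 ?addr0 //.
by rewrite (negbTE ji) mulr0.
Qed.

Lemma dot_bin2vec (R : realType) (n : nat) (a : binvec n) (y : 'cV[R]_n) :
  dot (bin2vec R a) y = \sum_(i | a i 0) y i 0.
Proof.
rewrite dot_sum [RHS]big_mkcond; apply: eq_bigr => i _.
by rewrite mxE; case: (a i 0); rewrite ?mul1r ?mul0r.
Qed.

Lemma dot_const1 (R : realType) (n : nat) (y : 'cV[R]_n) :
  dot (const_mx 1) y = \sum_i y i 0.
Proof. by rewrite dot_sum; apply: eq_bigr => i _; rewrite mxE mul1r. Qed.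

Lemma vecle_bin2vec (R : realType) (n : nat) (x w : binvec n) :
  vecle (bin2vec R x) (bin2vec R w) = [forall i, x i 0 ==> w i 0].
Proof.
by apply: eq_forallb => i; rewrite !mxE; case: (x i 0); case: (w i 0);
  rewrite ?lexx ?ler01 ?ler10.
Qed.

(** The binary vector [e_i]. *)
Definition unitbin (n : nat) (i : 'I_n) : binvec n := \col_k (k == i).

Lemma bin2vec_unitbin (R : realType) (n : nat) (i : 'I_n) :
  bin2vec R (unitbin i) = unitvec R i.
Proof. by apply/matrixP => k l; rewrite !mxE (ord1 l) eqxx andbT. Qed.

Lemma bin2vec0 (R : realType) (n : nat) :
  bin2vec R (const_mx false : binvec n) = 0.
Proof. by apply/matrixP => k l; rewrite !mxE. Qed.

Section CombGame.
Variables (R : realType) (n : nat) (f : 'cV[R]_n -> R).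

Lemma le_comb_game (x w : binvec n) :
  (forall i, x i 0 -> w i 0) -> f (bin2vec R x) <= comb_game f w.
Proof.
move=> xw; apply: (@le_bigmax_cond _ _ _ _ _ _ (fun x => f (bin2vec R x))).
by rewrite vecle_bin2vec; apply/forallP => i; apply/implyP/xw.
Qed.

Lemma comb_game_attained (w : binvec n) :
  exists2 x : binvec n, forall i, x i 0 -> w i 0 & comb_game f w = f (bin2vec R x).
Proof.
rewrite /comb_game.
elim/big_ind: _ => [|u v [x xw ->] [y yw ->]|x].
- by exists (const_mx false) => [i|]; rewrite ?mxE ?bin2vec0.
- by rewrite maxEle; case: ifP => _; [exists y | exists x].
- by rewrite vecle_bin2vec => /forallP xw; exists x => // i; apply/implyP.
Qed.

End CombGame.

Section QuadraticGame.
Variables (R : realType) (n : nat) (b : 'cV[R]_n) (Q : 'M[R]_n).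

Let f := quadfun b Q.
Let c := b + diagvec Q.
Let nu := comb_game f.

Lemma quadfun_bin (x : binvec n) :
  f (bin2vec R x) = \sum_(i | x i 0) c i 0
    + \sum_(i | x i 0) \sum_(j | x j 0 && (j != i)) Q i j.
Proof.
have dotC (u v : 'cV[R]_n) : dot u v = dot v u.
  by rewrite !dot_sum; apply: eq_bigr => i _; rewrite mulrC.
rewrite /f /quadfun dotC !dot_bin2vec -!big_split /=; apply: eq_bigr => i xi.
rewrite !mxE -addrA; congr (_ + _).
rewrite -(@bigD1 _ _ _ _ i (fun j => x j 0)) //= [RHS]big_mkcond.
by apply: eq_bigr => j _; rewrite mxE; case: (x j 0); rewrite ?mulr1 ?mulr0.
Qed.

Lemma quadfun_unitvec (i : 'I_n) : f (unitvec R i) = c i 0.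
Proof.
rewrite -bin2vec_unitbin quadfun_bin.
have E k : unitbin i k 0 = (k == i) by rewrite mxE.
rewrite !(eq_bigl _ _ E) !big_pred1_eq big1 ?addr0 // => j.
by rewrite E andbN.
Qed.

Lemma sum_quadfun_unitvec (x : binvec n) :
  \sum_i f (unitvec R i) * bin2vec R x i 0 = \sum_(i | x i 0) c i 0.
Proof.
rewrite -dot_bin2vec dot_sum; apply: eq_bigr => i _.
by rewrite quadfun_unitvec mulrC.
Qed.

Lemma individually_subadditiveP : Q^T = Q ->
  individually_subadditive f <-> (forall i j : 'I_n, i != j -> Q i j <= 0).
Proof.
move=> Qsym; split=> [sub i j ij | Qle x]; last first.
  rewrite sum_quadfun_unitvec quadfun_bin gerDl.
  apply: sumr_le0 => i _; apply: sumr_le0 => j /andP[_ ji].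
  by apply: Qle; rewrite eq_sym.
have ji : j != i by rewrite eq_sym.
(* At [x = e_i + e_j] the inequality reads [q_ij + q_ji <= 0]. *)
pose x : binvec n := \col_k ((k == i) || (k == j)).
have xE k : x k 0 = ((k == i) || (k == j)) by rewrite mxE.
have := sub x; rewrite sum_quadfun_unitvec quadfun_bin gerDl.
rewrite (bigD1 i) ?xE ?eqxx //= (big_pred1 j) => [|k]; last first.
  by rewrite xE /=; case: (eqVneq k i) => [->|] /=; rewrite ?(negbTE ij) ?andbT.
rewrite (big_pred1 j) => [|k]; last first.
  by rewrite xE /=; case: (eqVneq k i) => [->|] /=; rewrite ?(negbTE ij) ?andbT.
rewrite (big_pred1 i) => [|k]; last first.
  by rewrite xE /=; case: (eqVneq k j) => [->|] /=; rewrite ?(negbTE ji) ?orbF ?andbT ?andbF.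
have -> : Q j i = Q i j by rewrite -[in LHS]Qsym mxE.
by rewrite -mulr2n pmulrn_lle0.
Qed.

Lemma vecpos_ge0 (z : 'cV[R]_n) (i : 'I_n) : 0 <= vecpos z i 0.
Proof. by rewrite mxE le_max lexx orbT. Qed.

Lemma vecpos_ge (z : 'cV[R]_n) (i : 'I_n) : z i 0 <= vecpos z i 0.
Proof. by rewrite mxE le_max lexx. Qed.

(** Player [i] alone earns at least [c_i^+], since both [e_i] and [0] are
    feasible. *)
Lemma vecpos_le_comb_game (i : 'I_n) : vecpos c i 0 <= nu (unitbin i).
Proof.
rewrite mxE ge_max -quadfun_unitvec -bin2vec_unitbin; apply/andP; split.
  exact: le_comb_game.
have <- : f (bin2vec R (const_mx false)) = 0.
  by rewrite quadfun_bin !big1 ?addr0 // => j; rewrite mxE.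
by apply: le_comb_game => k; rewrite mxE.
Qed.

(** The indicator of the set [{k | c_k > 0}]. *)
Definition posind : binvec n := \col_i (0 < c i 0).

Lemma quadfun_posind :
  (forall i j : 'I_n, i != j -> 0 < c i 0 -> 0 < c j 0 -> Q i j = 0) ->
  f (bin2vec R posind) = \sum_i vecpos c i 0.
Proof.
move=> Q0; have pE k : posind k 0 = (0 < c k 0) by rewrite mxE.
rewrite quadfun_bin [X in _ + X]big1 ?addr0 => [|i]; last first.
  rewrite pE => ci; apply: big1 => j; rewrite pE => /andP[cj ji].
  by apply: Q0; rewrite // eq_sym.
rewrite big_mkcond; apply: eq_bigr => i _; rewrite pE [RHS]mxE.
by rewrite maxC /Num.max.
Qed.

Section NonposOffDiagonal.
Hypothesis Qle : forall i j : 'I_n, i != j -> Q i j <= 0.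

Lemma comb_game_le_pos (w : binvec n) : nu w <= \sum_(i | w i 0) vecpos c i 0.
Proof.
rewrite /nu; have [x xw ->] := comb_game_attained f w; rewrite quadfun_bin.
apply: (@le_trans _ _ (\sum_(i | x i 0) vecpos c i 0)).
  rewrite -[leRHS]addr0; apply: lerD.
    by apply: ler_sum => i _; exact: vecpos_ge.
  apply: sumr_le0 => i _; apply: sumr_le0 => j /andP[_ ji].
  by apply: Qle; rewrite eq_sym.
rewrite big_mkcond [leRHS]big_mkcond; apply: ler_sum => i _.
by case: ifP => [/xw -> //|_]; case: ifP => // _; exact: vecpos_ge0.
Qed.

Lemma quadfun_eq_pos (x : binvec n) (i j : 'I_n) :
  f (bin2vec R x) = \sum_k vecpos c k 0 ->
  i != j -> 0 < c i 0 -> 0 < c j 0 -> Q i j = 0.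
Proof.
move=> fx ij ci cj.
(* The slack [sum_k c_k^+ - f(x)] of the upper bound is the sum of the
   nonnegative terms [gap] and [loss], so each of them vanishes. *)
pose gap k := vecpos c k 0 - (if x k 0 then c k 0 else 0).
pose loss k := \sum_(l | x l 0 && (l != k)) - Q k l.
have Qge k l : x l 0 && (l != k) -> 0 <= - Q k l.
  by move=> /andP[_ lk]; rewrite oppr_ge0 Qle // eq_sym.
have gap_ge0 k : 0 <= gap k.
  by rewrite subr_ge0; case: ifP => _; rewrite ?vecpos_ge ?vecpos_ge0.
have loss_ge0 k : 0 <= loss k by apply: sumr_ge0 => l; exact: Qge.
have tot : \sum_k gap k + \sum_(k | x k 0) loss k = 0.
  rewrite sumrB -big_mkcond /= -fx quadfun_bin.
  have -> : \sum_(k | x k 0) loss k =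
      - \sum_(k | x k 0) \sum_(l | x l 0 && (l != k)) Q k l.
    by rewrite -sumrN; apply: eq_bigr => k _; rewrite /loss sumrN.
  by rewrite -addrA -opprD subrr.
have /andP[/eqP gap0 /eqP loss0] :
    (\sum_k gap k == 0) && (\sum_(k | x k 0) loss k == 0).
  by rewrite -paddr_eq0 ?tot ?eqxx //; apply: sumr_ge0.
have pos_in k : 0 < c k 0 -> x k 0.
  move=> ck; have : gap k = 0 by apply: (psumr_eq0P _ gap0).
  rewrite /gap; case: (x k 0) => //; rewrite subr0 => c0.
  by have := vecpos_ge c k; rewrite c0 leNgt ck.
have lossi : loss i = 0 by apply: (psumr_eq0P _ loss0) => //; exact: pos_in.
apply/eqP; rewrite -oppr_eq0; apply/eqP.
by apply: (psumr_eq0P (@Qge i) lossi); rewrite pos_in // eq_sym.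
Qed.

Lemma core_eq_pos (y : 'cV[R]_n) : core nu y -> y = vecpos c.
Proof.
move=> [ysum yge].
have cy i : vecpos c i 0 <= y i 0.
  apply: le_trans (vecpos_le_comb_game i) _.
  have := yge (unitbin i); rewrite dot_bin2vec (big_pred1 i) // => k.
  by rewrite mxE.
have sum0 : \sum_i (y i 0 - vecpos c i 0) = 0.
  apply/eqP; rewrite eq_le sumr_ge0 ?andbT => [|i _]; last by rewrite subr_ge0.
  rewrite sumrB subr_le0 -dot_const1 ysum.
  apply: le_trans (comb_game_le_pos _) _.
  by rewrite (eq_bigl xpredT) // => k; rewrite mxE.
apply/matrixP => i k; rewrite (ord1 k); apply/eqP; rewrite -subr_eq0; apply/eqP.
by apply: (psumr_eq0P _ sum0) => // l _; rewrite subr_ge0.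
Qed.

Lemma core_vecpos :
  (forall i j : 'I_n, i != j -> 0 < c i 0 -> 0 < c j 0 -> Q i j = 0) ->
  core nu (vecpos c).
Proof.
move=> Q0; split=> [|a]; last by rewrite dot_bin2vec comb_game_le_pos.
apply/eqP; rewrite dot_const1 eq_le; apply/andP; split.
  by rewrite -quadfun_posind //; apply: le_comb_game => i _; rewrite mxE.
apply: le_trans (comb_game_le_pos _) _.
by rewrite (eq_bigl xpredT) // => k; rewrite mxE.
Qed.

Lemma core_vecpos_offdiag : core nu (vecpos c) ->
  forall i j : 'I_n, i != j -> 0 < c i 0 -> 0 < c j 0 -> Q i j = 0.
Proof.
move=> [tot _] i j; have [x _ nux] := comb_game_attained f (const_mx true).
by apply: (@quadfun_eq_pos x); rewrite -nux -dot_const1 tot.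
Qed.

End NonposOffDiagonal.
End QuadraticGame.

Theorem proposition2 (R : realType) (n : nat) (b : 'cV[R]_n) (Q : 'M[R]_n)
    (Qsym : Q^T = Q) :
  let f := quadfun b Q in
  let q := diagvec Q in
  let nu := comb_game f in
  (individually_subadditive f <-> (forall i j : 'I_n, i != j -> Q i j <= 0))
  /\ (individually_subadditive f ->
      (core nu !=set0 <->
         (forall i j : 'I_n, i != j ->
            0 < dot (b + q) (unitvec R i) -> 0 < dot (b + q) (unitvec R j) ->
            Q i j = 0))
      /\ (core nu !=set0 -> core nu = [set vecpos (b + q)])).
Proof.
move=> f q nu; split; first exact: individually_subadditiveP.
move=> /(individually_subadditiveP b Qsym) Qle; split.
  split=> [[y cy] i j ij | Q0].
    rewrite !dot_unitvec; apply: core_vecpos_offdiag ij => //.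
    by rewrite -(core_eq_pos Qle cy).
  exists (vecpos (b + q)); apply: core_vecpos => // i j ij ci cj.
  by apply: Q0; rewrite ?dot_unitvec.
move=> [y cy]; apply/seteqP; split=> [z /(core_eq_pos Qle) -> // | z ->].
by rewrite -(core_eq_pos Qle cy).
Qed.
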